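(* Let $$\mathcal{U}^{P}(\mathbf{x})=\Big\{\boldsymbol{\xi}\ \Big|\ \mathbf{D}_{i\cdot}^\top\boldsymbol{\xi}\le d_i+\sum_{j=1}^n\Delta_{ij}x_j\quad\forall i=1,\dots,m\Big\},\qquad \mathbf{x}\in\{0,1\}^n.$$ If $\Delta_{ij}\ge0$ for all $i,j$, then the constraint $$\mathbf{y}^\top\boldsymbol{\xi}\le b\qquad\forall\boldsymbol{\xi}\in\mathcal{U}^{P}(\mathbf{x})$$ can, with a large constant $M$, be reformulated as $$\begin{aligned}&\sum_{i=1}^m\pi_id_i+\sum_{i=1}^m\sum_{j=1}^nt_{ij}\le b,\\ &\sum_{i=1}^m\pi_iD_{ij}=y_j&&\forall j,\\ &t_{ij}\ge\pi_i\Delta_{ij}-M(1-x_j),\quad \pi_i\ge0,\quad t_{ij}\ge0&&\forall i,j.\end{aligned}$$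
   Context: $\mathbf{D}=(D_{ij})$ is a real matrix with $m$ rows, $\mathbf{D}_{i\cdot}$ is its $i$-th row (written as a vector), $\mathbf{d}=(d_i)\in\mathbb{R}^m$, $\boldsymbol{\Delta}=(\Delta_{ij})\in\mathbb{R}^{m\times n}$, $b\in\mathbb{R}$; $\boldsymbol{\xi}$ and $\mathbf{y}$ are real vectors with as many components as $\mathbf{D}$ has columns, and in the equality constraints $j$ runs over these components. $\boldsymbol{\pi}=(\pi_i)\in\mathbb{R}^m$ and $\mathbf{t}=(t_{ij})\in\mathbb{R}^{m\times n}$ are auxiliary variables of the reformulation. In the last line $i=1,\dots,m$ and $j=1,\dots,n$.
   Formalization: It is assumed that the uncertainty set is nonempty or that some π ≥ 0 satisfies the equality constraints (otherwise the claim fails), and the large constant M may depend on a bound for the components of y, since no M serves all y at once. *)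

(* Defs.v *)
From mathcomp Require Import all_boot all_order all_algebra.
From mathcomp Require Import classical_sets reals.

Set Implicit Arguments.
Unset Strict Implicit.
Unset Printing Implicit Defensive.

Import Order.TTheory GRing.Theory Num.Theory.
Local Open Scope classical_set_scope.
Local Open Scope ring_scope.

(* All vectors are column vectors; [k] is the number of columns of [D], i.e.
   the dimension of the uncertain parameter [xi]. *)

Definition binary (R : realType) (n : nat) (x : 'cV[R]_n) : Prop :=
  forall j, x j 0 = 0 \/ x j 0 = 1.

Definition uncertainty_set (R : realType) (m n k : nat)
    (D : 'M[R]_(m, k)) (d : 'cV[R]_m) (Delta : 'M[R]_(m, n)) (x : 'cV[R]_n) :
    set 'cV[R]_k :=
  [set xi | forall i, \sum_j D i j * xi j 0 <= d i 0 + \sum_j Delta i j * x j 0].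

Definition robust_constraint (R : realType) (k : nat)
    (U : set 'cV[R]_k) (y : 'cV[R]_k) (b : R) : Prop :=
  forall xi, U xi -> \sum_j y j 0 * xi j 0 <= b.

(* Feasible set of the dual of the inner problem
   [max { y^T xi | xi in uncertainty_set D d Delta x }];
   it depends neither on [d] nor on [x]. *)
Definition dual_feasible_set (R : realType) (m k : nat)
    (D : 'M[R]_(m, k)) (y : 'cV[R]_k) : set 'cV[R]_m :=
  [set p | (forall j, \sum_i p i 0 * D i j = y j 0) /\ forall i, 0 <= p i 0].

(* The sign constraints on [p] are imposed for every [i], also when [n = 0]. *)
Definition bigM_system (R : realType) (m n k : nat)
    (D : 'M[R]_(m, k)) (d : 'cV[R]_m) (Delta : 'M[R]_(m, n)) (b M : R)
    (x : 'cV[R]_n) (y : 'cV[R]_k) (p : 'cV[R]_m) (t : 'M[R]_(m, n)) : Prop :=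
  [/\ \sum_i p i 0 * d i 0 + \sum_i \sum_j t i j <= b,
      forall j, \sum_i p i 0 * D i j = y j 0,
      forall i j, t i j >= p i 0 * Delta i j - M * (1 - x j 0),
      forall i, 0 <= p i 0
    & forall i j, 0 <= t i j].

(* Main.v *)
(** Strong LP duality, encoded as membership of [(y, b)] in the cone spanned by
    the rows of [[D, d + Delta x], [0, 1]], gives a dual certificate [p]. By
    Caratheodory's theorem [(y, b)] is also a nonnegative combination of
    linearly independent rows, whose coefficients are bounded linearly in
    [(y, b)] with a constant depending on the matrix only. As there are
    finitely many binary [x], one [M] dominates all products [p_i Delta_ij];
    then [t_ij = p_i Delta_ij x_j] is feasible. *)
Require Import Defs.
From mathcomp Require Import all_boot all_order all_algebra.
From mathcomp Require Import boolp classical_sets reals.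

Import Order.TTheory GRing.Theory Num.Theory.
Local Open Scope ring_scope.

(* Bartl's induction on the number of rows: when the separator [z] found for
   the tail [A] violates the new row [a], project along [z] onto the kernel
   of [a]. *)
Lemma farkas {R : realFieldType} {m k : nat} (A : 'M[R]_(m, k))
    (w : 'rV[R]_k) :
  (exists2 v : 'rV[R]_m, forall i, 0 <= v 0 i & v *m A = w) \/
  (exists2 z : 'cV[R]_k, forall i, 0 <= (A *m z) i 0 & (w *m z) 0 0 < 0).
Proof.
elim: m A w => [|m IH] A w.
  have [->|w_neq0] := eqVneq w 0.
    by left; exists 0; [case | rewrite mul0mx].
  right; exists (- w^T); first by case.
  rewrite mulmxN mxE oppr_lt0 mxE lt_neqAle eq_sym; apply/andP; split.
    apply: contra_neq w_neq0 => /eqP.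
    rewrite psumr_eq0 => [/allP sq0|j _]; last by rewrite mxE -expr2 sqr_ge0.
    apply/rowP => j; have := sq0 j (mem_index_enum _).
    by rewrite !mxE -expr2 sqrf_eq0 => /eqP.
  by apply: sumr_ge0 => j _; rewrite mxE -expr2 sqr_ge0.
rewrite -[A]/(A : 'M_(1 + m, k)) -[A](@vsubmxK _ 1 m).
move: (@usubmx _ 1 m _ A) (@dsubmx _ 1 m _ A) => a {}A.
have [[v v_ge0 vA]|[z0 Az0 wz0]] := IH A w.
  left; exists (row_mx (0 : 'rV_1) v : 'rV_(1 + m)); last by rewrite [LHS](@mul_row_col _ 1 1 m) mul0mx add0r.
  move=> i; case: (@split_ordP 1 m i) => j ->.
    by rewrite (@row_mxEl _ 1 1 m) mxE.
  by rewrite (@row_mxEr _ 1 1 m).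
have [az0|az0] := leP 0 ((a *m z0) 0 0).
  right; exists z0 => // i; rewrite (@mul_col_mx _ 1 m).
  case: (@split_ordP 1 m i) => j ->; last by rewrite (@col_mxEd _ 1 m).
  by rewrite (@col_mxEu _ 1 m) ord1.
(* The scaling gives [a *m z = -1], so [1 + z *m a] is the projection onto the kernel of [a] along
   [z]. *)
pose z := (- (a *m z0) 0 0)^-1 *: z0.
have az : a *m z = - 1%:M.
  rewrite -scalemxAr [a *m z0]mx11_scalar scale_scalar_mx -raddfN /=.
  by congr _%:M; rewrite mxE eqxx mulr1n invrN mulNr mulVf // lt_eqF.
have Az i : 0 <= (A *m z) i 0.
  by rewrite -scalemxAr mxE mulr_ge0 // invr_ge0 oppr_ge0 ltW.
have wz : (w *m z) 0 0 < 0.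
  by rewrite -scalemxAr mxE pmulr_rlt0 // invr_gt0 oppr_gt0.
(* [A] and [w] are composed with this projection. In the first case the coefficient of [a] is
   nonnegative because [v] and [A *m z] are and [w *m z] is negative; in the second [a] vanishes on
   the projected separator. *)
have [[v v_ge0 vA]|[u Au wu]] := IH (A + A *m z *m a) (w + w *m z *m a).
  left; exists (row_mx (v *m (A *m z) - w *m z) v : 'rV_(1 + m)).
    move=> i; case: (@split_ordP 1 m i) => j ->; last by rewrite (@row_mxEr _ 1 1 m).
    rewrite (@row_mxEl _ 1 1 m) ord1 !mxE subr_ge0.
    rewrite (le_trans (y := 0)) //; first by move: wz; rewrite mxE => /ltW.
    by apply: sumr_ge0 => l _; apply: mulr_ge0.
  apply: (addIr (w *m z *m a)); rewrite -vA (@mul_row_col _ 1 1 m) mulmxBl mulmxDr.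
  by rewrite !mulmxA addrAC subrK addrC.
right; exists (u + z *m (a *m u)) => [i|].
  rewrite (@mul_col_mx _ 1 m); case: (@split_ordP 1 m i) => j ->.
    by rewrite (@col_mxEu _ 1 m) mulmxDr mulmxA az mulNmx mul1mx subrr mxE.
  by rewrite (@col_mxEd _ 1 m); move: (Au j); rewrite mulmxDl mulmxDr !mulmxA.
by move: wu; rewrite mulmxDl mulmxDr !mulmxA.
Qed.

(** Linear independence of the rows indexed by [S], tested on full-length coefficient vectors so
    that no submatrix is extracted. *)
Definition rows_free {R : nzRingType} {m k : nat} (A : 'M[R]_(m, k))
    (S : {set 'I_m}) :=
  forall u : 'rV[R]_m,
    (forall i, i \notin S -> u 0 i = 0) -> u *m A = 0 -> u = 0.

Definition row_support {R : nmodType} {m : nat} (v : 'rV[R]_m) : {set 'I_m} :=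
  [set i | v 0 i != 0]%SET.

(** Induction on the size of the support: as long as the supporting rows are dependent, a multiple
    of a dependency can be subtracted to kill a coefficient. *)
Lemma caratheodory {R : realFieldType} {m k : nat} (A : 'M[R]_(m, k))
    (v : 'rV[R]_m) :
  (forall i, 0 <= v 0 i) ->
  exists v' : 'rV[R]_m, [/\ forall i, 0 <= v' 0 i, v' *m A = v *m A
    & rows_free A (row_support v')].
Proof.
have [n] := ubnP #|row_support v|; elim: n v => // n IH v lt_n v_ge0.
have [Sfree|] := pselect (rows_free A (row_support v)); first by exists v.
move=> /existsNP[u0 /not_implyP[u0S /not_implyP[u0A /eqP u0_neq0]]].
have [u [uS uA [i0 ui0]]] : exists u : 'rV[R]_m,
    [/\ forall i, v 0 i = 0 -> u 0 i = 0, u *m A = 0 & exists i, 0 < u 0 i].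
  have {}u0S i : v 0 i = 0 -> u0 0 i = 0.
    by move=> vi0; apply: u0S; rewrite inE vi0 eqxx.
  have /rV0Pn[i] := u0_neq0; rewrite neq_lt => /orP[ui|ui]; last first.
    by exists u0; split => //; exists i.
  exists (- u0); split; first by move=> j /u0S uj; rewrite mxE uj oppr0.
    by rewrite mulNmx u0A oppr0.
  by exists i; rewrite mxE oppr_gt0.
(* Ratio test: the least [q i] with [u 0 i > 0] is the largest multiple of [u] whose subtraction
   keeps all coefficients nonnegative. *)
pose q i := v 0 i / u 0 i.
have [i1 ui1 i1_min] := @arg_minP _ R _ i0 (fun i => 0 < u 0 i) q ui0.
have vu_ge0 i : 0 <= (v - q i1 *: u) 0 i.
  rewrite !mxE subr_ge0; have [ui|ui] := ltP 0 (u 0 i).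
    by rewrite -ler_pdivlMr // i1_min.
  by rewrite (le_trans _ (v_ge0 i)) // mulr_ge0_le0 // divr_ge0 // ltW.
have [|v' [v'_ge0 v'A v'S]] := IH (v - q i1 *: u) _ vu_ge0.
  rewrite -ltnS; apply: leq_trans lt_n; rewrite ltnS; apply/proper_card/properP.
  split.
    apply/fintype.subsetP => i; rewrite !inE; apply: contra_neq => vi.
    by rewrite !mxE vi uS // mulr0 subr0.
  exists i1; rewrite !inE; first by apply: contraTneq ui1 => /uS ->; rewrite ltxx.
  by rewrite !mxE divfK ?subrr ?eqxx ?(gt_eqF ui1).
by exists v'; split=> //; rewrite v'A mulmxBl -scalemxAl uA scaler0 subr0.
Qed.

(** Both sides are supported on [S] and have the same product with [A], since [v *m A] lies in the
    row space of [P *m A]. Thus [v] depends on [v *m A] through a matrix fixed by [A] and [S]. *)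
Lemma rows_free_coord {R : fieldType} {m k : nat} (A : 'M[R]_(m, k))
    (S : {set 'I_m}) (v : 'rV[R]_m) :
  let P : 'M[R]_m := diag_mx (\row_i (i \in S)%:R) in
  rows_free A S -> (forall i, i \notin S -> v 0 i = 0) ->
  v = v *m A *m pinvmx (P *m A) *m P.
Proof.
move=> P Sfree vS.
have PE (u : 'rV_m) i : (u *m P) 0 i = u 0 i * (i \in S)%:R.
  by rewrite mul_mx_diag !mxE.
have vP : v = v *m P.
  apply/rowP => i; rewrite PE; have [|/vS ->] := boolP (i \in S).
    by rewrite mulr1.
  by rewrite mul0r.
apply/eqP; rewrite -subr_eq0; apply/eqP/Sfree => [i iS|].
  by rewrite mxE [X in _ + X]mxE PE vS // (negPf iS) mulr0 oppr0 addr0.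
rewrite mulmxBl; apply/eqP; rewrite subr_eq0; apply/eqP.
by rewrite -[RHS]mulmxA mulmxKpV // {1}vP -mulmxA submxMl.
Qed.

(** Coefficients on independent rows come from one of finitely many linear maps [L S]; [C] adds up
    the absolute values of all their entries. *)
Lemma bounded_conic_coord {R : realFieldType} {m k : nat} (A : 'M[R]_(m, k)) :
  exists2 C : R, 0 <= C & forall v : 'rV[R]_m, (forall i, 0 <= v 0 i) ->
    exists v' : 'rV[R]_m, [/\ forall i, 0 <= v' 0 i, v' *m A = v *m A
      & forall i, v' 0 i <= C * \sum_j `|(v *m A) 0 j|].
Proof.
pose P (S : {set 'I_m}) : 'M[R]_m := diag_mx (\row_i (i \in S)%:R).
pose L S := pinvmx (P S *m A) *m P S.
pose C := \sum_S \sum_i \sum_j `|L S j i|.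
have LC S i j : `|L S j i| <= C.
  rewrite /C (bigD1 S) //= (bigD1 i) //= (bigD1 j) //= -!addrA lerDl.
  by rewrite !addr_ge0 //; do ?apply: sumr_ge0 => ? _.
exists C; first by do 3!apply: sumr_ge0 => ? _.
move=> v v_ge0; have [v' [v'_ge0 v'A v'free]] := caratheodory A v v_ge0.
exists v'; split=> // i; set w := v *m A.
have -> : v' = w *m L (row_support v').
  rewrite /w /L mulmxA -v'A; apply: rows_free_coord => // l.
  by rewrite inE negbK => /eqP.
rewrite mxE mulr_sumr; apply: ler_sum => j _.
by rewrite (le_trans (ler_norm _)) // normrM mulrC ler_wpM2r.
Qed.

(** The last entry of [v] is the slack in the dual bound. A separator [(z, t)] with [t > 0] yields
    the point [- z / t], which violates the bound; if [t = 0], then [z] contradicts the dual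
    certificate or makes [y] unbounded. *)
Lemma affine_farkas {R : realFieldType} {m k : nat} (D : 'M[R]_(m, k))
    (c : 'cV[R]_m) (y : 'rV[R]_k) (b : R) :
  (exists xi : 'cV[R]_k, forall i, (D *m xi) i 0 <= c i 0) \/
    (exists2 p : 'rV[R]_m, forall i, 0 <= p 0 i & p *m D = y) ->
  (forall xi : 'cV[R]_k, (forall i, (D *m xi) i 0 <= c i 0) -> (y *m xi) 0 0 <= b) ->
  exists2 v : 'rV[R]_(m + 1), forall i, 0 <= v 0 i
    & v *m block_mx D c 0 1%:M = row_mx y b%:M.
Proof.
move=> feas yb; have [//|[z Az wz]] := farkas (block_mx D c 0 1%:M) (row_mx y b%:M).
exfalso; move: Az wz; rewrite -[z]vsubmxK.
move: (usubmx z) (dsubmx z) => {z} z t.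
rewrite mul_block_col mul0mx mul1mx add0r mul_row_col mul_scalar_mx => Azt.
have Az i : 0 <= (D *m z) i 0 + c i 0 * t 0 0.
  by have := Azt (lshift 1 i); rewrite col_mxEu mxE [X in _ + X]mxE big_ord1.
have t_ge0 : 0 <= t 0 0 by have := Azt (rshift m 0); rewrite col_mxEd.
rewrite mxE [X in _ + X]mxE => {Azt}.
move: t_ge0; rewrite le_eqVlt eq_sym => /orP[/eqP t0|t_gt0] wz; last first.
  have /yb : forall i, (D *m (- (t 0 0)^-1 *: z)) i 0 <= c i 0.
    move=> i; rewrite -scalemxAr mxE mulNr mulrC -mulNr ler_pdivrMr //.
    by rewrite -subr_ge0 opprK addrC.
  rewrite -scalemxAr mxE mulNr mulrC -mulNr ler_pdivrMr // -subr_ge0 opprK.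
  by rewrite addrC leNgt wz.
rewrite t0 mulr0 addr0 in wz.
have {}Az i : 0 <= (D *m z) i 0 by have := Az i; rewrite t0 mulr0 addr0.
case: feas => [[xi xiU]|[p p_ge0 pD]]; last first.
  by move: wz; rewrite -pD -mulmxA mxE ltNge sumr_ge0 // => i _; apply: mulr_ge0.
(* Moving from [xi] along [- z] stays in the polyhedron and makes [y] unbounded. *)
pose s := (b + 1 - (y *m xi) 0 0) / - (y *m z) 0 0.
have s_ge0 : 0 <= s.
  apply: divr_ge0; last by rewrite oppr_ge0 ltW.
  by rewrite subr_ge0 (le_trans (yb _ xiU)) // lerDl.
have /yb : forall i, (D *m (xi - s *: z)) i 0 <= c i 0.
  move=> i; rewrite mulmxBr -scalemxAr !mxE.
  apply: le_trans (xiU i); rewrite [leRHS]mxE gerDl oppr_le0.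
  by apply: mulr_ge0 => //; have := Az i; rewrite mxE.
rewrite mulmxBr -scalemxAr mxE [X in _ + X]mxE [X in _ - X]mxE -mulrN.
rewrite divfK ?oppr_eq0 ?lt_eqF // addrC subrK => b1.
by move: b1; rewrite gerDl ler10.
Qed.

Local Open Scope classical_set_scope.

Theorem proposition5 (R : realType) (m n k : nat)
    (D : 'M[R]_(m, k)) (d : 'cV[R]_m) (Delta : 'M[R]_(m, n)) (b : R)
    (Delta_ge0 : forall i j, 0 <= Delta i j) (r : R) :
  exists M0 : R, forall M : R, M0 <= M ->
  forall (x : 'cV[R]_n) (y : 'cV[R]_k),
    binary x ->
    (forall j, `|y j 0| <= r) ->
    uncertainty_set D d Delta x !=set0 \/ dual_feasible_set D y !=set0 ->
    robust_constraint (uncertainty_set D d Delta x) y b <->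
    exists (p : 'cV[R]_m) (t : 'M[R]_(m, n)),
      bigM_system D d Delta b M x y p t.
Proof.
pose A (x : 'cV[R]_n) := block_mx D (d + Delta *m x) 0 1%:M.
pose B (f : {ffun 'I_n -> bool}) := A (\col_j (f j)%:R).
have /fin_all_exists2[C C_ge0 CP] f := bounded_conic_coord (B f).
(* Summing over [f] bounds the multipliers for every binary [x] at once; [|r|] keeps the terms
   nonnegative even if [r] is negative. *)
pose K := \sum_f C f * (\sum_(j < k) `|r| + `|b|).
exists (\sum_i \sum_j K * Delta i j) => M le_M x y xbin yr feas.
split=> [rob|[p [t [ptb pD tM p_ge0 t_ge0]]] xi xiU]; last first.
  (* Weak duality: [t i j] dominates [p i 0 * Delta i j * x j 0], by its sign if [x j 0 = 0] and by
     the big-M row if [x j 0 = 1]. *)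
  have -> : \sum_j y j 0 * xi j 0 = \sum_i p i 0 * \sum_j D i j * xi j 0.
    under eq_bigr => j _ do rewrite -pD mulr_suml.
    rewrite exchange_big /=; apply: eq_bigr => i _; rewrite mulr_sumr.
    by apply: eq_bigr => j _; rewrite mulrA.
  apply: le_trans ptb; rewrite -big_split /=; apply: ler_sum => i _.
  apply: le_trans (ler_wpM2l (p_ge0 i) (xiU i)) _.
  rewrite mulrDr lerD2l mulr_sumr; apply: ler_sum => j _.
  have [->|xj] := xbin j; first by rewrite !mulr0.
  by have := tM i j; rewrite xj subrr mulr0 subr0 mulr1.
pose f := [ffun j => x j 0 == 1].
have fx : B f = A x.
  congr A; apply/colP => j; rewrite mxE ffunE.
  by have [->|->] := xbin j; rewrite ?eqxx // eq_sym oner_eq0.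
have UE xi : uncertainty_set D d Delta x xi <->
    forall i, (D *m xi) i 0 <= (d + Delta *m x) i 0.
  by split=> xiU i; have := xiU i; rewrite !mxE.
have [||v v_ge0 vA] := @affine_farkas R m k D (d + Delta *m x) y^T b.
- case: feas => [[xi /UE xiU]|[p [pD p_ge0]]]; [left; by exists xi | right].
  exists p^T => [i|]; first by rewrite mxE.
  by apply/rowP => j; rewrite !mxE -pD; apply: eq_bigr => i _; rewrite mxE.
- move=> xi /UE/rob; rewrite mxE; congr (_ <= _).
  by apply: eq_bigr => j _; rewrite mxE.
have [v' [v'_ge0 v'A v'C]] := CP f v v_ge0.
rewrite fx vA in v'A v'C; pose p := (lsubmx v')^T.
have pE i : p i 0 = v' 0 (lshift 1 i) by rewrite !mxE.
have p_ge0 i : 0 <= p i 0 by rewrite pE.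
have [pD pc] : lsubmx v' *m D = y^T /\
    lsubmx v' *m (d + Delta *m x) + rsubmx v' = b%:M.
  apply: eq_row_mx; rewrite -v'A /A -[in RHS](hsubmxK v') mul_row_block.
  by rewrite mulmx0 mulmx1 addr0.
have pK i : p i 0 <= K.
  rewrite pE (le_trans (v'C _)) // /K (bigD1 f) //=.
  apply: (@le_trans _ _ (C f * (\sum_(j < k) `|r| + `|b|))); last first.
    rewrite lerDl; apply: sumr_ge0 => g _; apply: mulr_ge0 => //.
    by apply: addr_ge0 => //; apply: sumr_ge0.
  apply: ler_wpM2l => //; rewrite big_split_ord big_ord1 /=.
  rewrite row_mxEr mxE eqxx mulr1n lerD2r; apply: ler_sum => j _.
  by rewrite row_mxEl mxE (le_trans (yr j)) ?ler_norm.
have pDelta_le_M i j : p i 0 * Delta i j <= M.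
  apply: le_trans le_M; apply: le_trans (ler_wpM2r (Delta_ge0 i j) (pK i)) _.
  (* [K] is nonnegative because it bounds [p i 0]. *)
  have KDelta_ge0 i' j' : 0 <= K * Delta i' j'.
    by rewrite mulr_ge0 // (le_trans (p_ge0 i)).
  rewrite (bigD1 i) //= (bigD1 j) //= -addrA lerDl.
  by rewrite addr_ge0 //; do ?apply: sumr_ge0 => ? _.
exists p, (\matrix_(i, j) (p i 0 * Delta i j * x j 0)); split.
- have <- : \sum_i p i 0 * (d + Delta *m x) i 0 =
      \sum_i p i 0 * d i 0 +
      \sum_i \sum_j (\matrix_(i, j) (p i 0 * Delta i j * x j 0)) i j.
    rewrite -big_split /=; apply: eq_bigr => i _.
    rewrite !mxE mulrDr mulr_sumr; congr (_ + _).
    by apply: eq_bigr => j _; rewrite !mxE mulrA.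
  (* Dropping the nonnegative slack [rsubmx v'] turns [pc] into the inequality. *)
  have := congr1 (fun X : 'M_1 => X 0 0) pc.
  rewrite mxE [X in X + _]mxE [RHS]mxE eqxx mulr1n => <-.
  under eq_bigr => i _ do rewrite mxE.
  by rewrite lerDl mxE.
- move=> j; have := congr1 (fun X : 'rV_k => X 0 j) pD.
  by rewrite !mxE => <-; apply: eq_bigr => i _; rewrite !mxE.
(* Only [x j 0 = 0] needs [M] to be large; for [x j 0 = 1] the row holds with equality. *)
- move=> i j; rewrite [leRHS]mxE; have [->|->] := xbin j.
    by rewrite subr0 mulr0 mulr1 subr_le0.
  by rewrite subrr mulr0 subr0 mulr1.
- by [].
- move=> i j; rewrite mxE; have [->|->] := xbin j; first by rewrite mulr0.
  by rewrite mulr1 mulr_ge0.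
Qed.
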